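(* Let $\mathcal{B}=\{u_1,\dots,u_N\}$ be an orthonormal basis of $\mathbb{K}^N$, with associated unitary matrix $U$, let $X$ be a Banach space over $\mathbb{K}$, and let $f\in X^N\setminus\{0\}$. Then, for every $q\in[1,\infty]$, $$\frac{\|f\|_1\,\|\hat f\|_1}{\|f\|_q\,\|\hat f\|_q}\ge\frac{1}{\kappa_q(U)\,\kappa_q(U^* )} .$$ In particular, $$\frac{\|f\|_1\,\|\hat f\|_1}{\|f\|_\infty\,\|\hat f\|_\infty}\ge\frac{1}{\kappa(U)^2},\qquad \frac{\|f\|_1\,\|\hat f\|_1}{\|f\|_2\,\|\hat f\|_2}\ge1 .$$
   Context: $\mathbb{K}$ is $\mathbb{R}$ or $\mathbb{C}$, $N\ge 1$. An $X$-valued signal is a function $f:\{1,\dots,N\}\to X$, identified with $(f(1),\dots,f(N))\in X^N$. Norms: $\|f\|_p=\left(\sum_{n=1}^N\|f(n)\|^p\right)^{1/p}$ for $p\in[1,\infty)$ and $\|f\|_\infty=\max_{1\le n\le N}\|f(n)\|$. $U$ is the $N\times N$ unitary matrix whose $k$-th column is $u_k=(u_k(1),\dots,u_k(N))$, i.e. its entry in row $n$, column $k$ is $u_k(n)$; its $n$-th row is $u(n)=(u_1(n),\dots,u_N(n))$; $U^*$ is its conjugate transpose. Graph Fourier transform of $f$: $\hat f\in X^N$, $\hat f(k)=\sum_{n=1}^N\overline{u_k(n)}f(n)$. Coherence: $\kappa(U)=\max_{k,n}|u_k(n)|$, and for $r\in[1,\infty]$, $\kappa_r(U)=\max_{1\le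 k\le N}\|u_k\|_r$ with the usual $\ell^r$ norm on $\mathbb{K}^N$ (maximum over columns); hence $\kappa_r(U^* )=\max_{1\le n\le N}\|u(n)\|_r$. *)

(* Defs.v *)
From HB Require Import structures.
From mathcomp Require Import all_boot all_order all_algebra complex.
From mathcomp Require Import all_classical all_reals all_analysis.
Set Implicit Arguments.
Unset Strict Implicit.
Unset Printing Implicit Defensive.
Import Order.TTheory GRing.Theory Num.Theory.
Import numFieldNormedType.Exports.
Local Open Scope ring_scope.

Inductive scalar_kind := RealScalars | ComplexScalars.

Definition scalars (R : realType) (k : scalar_kind) : numFieldType :=
  match k with
  | RealScalars => R
  | ComplexScalars => R[i]
  end.

Definition scalar_conj (R : realType) (k : scalar_kind) :
    scalars R k -> scalars R k :=
  match k return scalars R k -> scalars R k with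
  | RealScalars => id
  | ComplexScalars => @conjc R
  end.

Definition scalar_re (R : realType) (k : scalar_kind) : scalars R k -> R :=
  match k return scalars R k -> R with
  | RealScalars => id
  | ComplexScalars => @complex.Re R
  end.

Section GraphSignals.
Context {R : realType} {k : scalar_kind}.
Local Notation K := (scalars R k).

(* The library norm of a normed K-space takes its values in K; they are
   nonnegative, so real even when K is R[i], and rnorm reads them in R. *)
Definition rnorm {V : normedZmodType K} (x : V) : R := scalar_re `|x|.

(* Only p >= 1 is meaningful; the value at p = -oo is junk. The default 0 of
   the maximum is harmless because norms are nonnegative. *)
Definition lpnorm {V : normedZmodType K} {N : nat} (p : \bar R)
    (f : 'I_N -> V) : R :=
  match p with
  | r%:E%E => (\sum_(n < N) rnorm (f n) `^ r) `^ r^-1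
  | +oo%E => \big[Num.max/0]_(n < N) rnorm (f n)
  | -oo%E => 0
  end.

Definition inner {N : nat} (v w : 'cV[K]_N) : K :=
  \sum_(n < N) v n 0 * scalar_conj (w n 0).

Definition orthonormal_basis {N : nat} (u : 'I_N -> 'cV[K]_N) : Prop :=
  basis_of {:'cV[K]_N} [seq u j | j : 'I_N] /\
  forall i j, inner (u i) (u j) = (i == j)%:R.

(* The vectors are the columns: the entry in row n, column j is u_j(n). *)
Definition basis_mx {N : nat} (u : 'I_N -> 'cV[K]_N) : 'M[K]_N :=
  \matrix_(n, j) u j n 0.

Definition adjoint {N : nat} (U : 'M[K]_N) : 'M[K]_N :=
  (map_mx (@scalar_conj R k) U)^T.

Definition fourier {X : normedModType K} {N : nat} (U : 'M[K]_N)
    (f : 'I_N -> X) : 'I_N -> X :=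
  fun j => \sum_(n < N) scalar_conj (U n j) *: f n.

Definition coherence {N : nat} (U : 'M[K]_N) : R :=
  \big[Num.max/0]_(j < N) \big[Num.max/0]_(n < N) rnorm (U n j).

Definition kappa {N : nat} (r : \bar R) (U : 'M[K]_N) : R :=
  \big[Num.max/0]_(j < N) lpnorm r (fun n => U n j).

End GraphSignals.

(* Main.v *)
Require Import Defs.
From HB Require Import structures.
From mathcomp Require Import all_boot all_order all_algebra complex.
From mathcomp Require Import all_classical all_reals all_analysis.
Set Implicit Arguments.
Unset Strict Implicit.
Unset Printing Implicit Defensive.
Import Order.TTheory GRing.Theory Num.Theory.
Import numFieldNormedType.Exports.
Local Open Scope ring_scope.

(** The inverse transform writes [f] as the combination of the columns of [U]
    with coefficients [fourier U f], and the transform itself is the combination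
    of the columns of [adjoint U] with coefficients [f]. Now a combination of
    columns [a_n] with coefficients [g n] in [X] satisfies, by the triangle
    inequality in l^q, ||sum_n a_n g(n)||_q <= (max_n ||a_n||_q) ||g||_1
    ([lpnorm_mx_le]). Applied to the two matrices, this bounds
    ||fh||_q by kappa_q(adjoint U) ||f||_1 and ||f||_q by kappa_q(U) ||fh||_1; the
    product of the two bounds, divided by the nonzero quantity
    ||f||_q ||fh||_q, is the inequality for every [q].

    For a finite exponent the weighted triangle inequality in l^q comes from
    Jensen's inequality for the power function, with the norms of the [g n] as
    weights ([powR_weighted_sum_le]), which in turn is Young's inequality summed
    at the right slope.

    The two special cases come from the values of kappa_q: at infinity both
    constants are the coherence, since the maximum of the moduli of the entries
    does not see conjugate transposition; at 2 they are at most 1, since the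
    columns of [U] and those of its adjoint are unit vectors. *)

(** * Norms read in the real field *)

Section Scalars.
Context {R : realType} {k : scalar_kind}.
Local Notation K := (scalars R k).

Lemma scalar_reD (x y : K) : scalar_re (x + y) = scalar_re x + scalar_re y.
Proof. by case: k x y => //= -[a b] [c d]. Qed.

Lemma scalar_re0 : scalar_re (0 : K) = 0.
Proof. by case: k. Qed.

Lemma scalar_re1 : scalar_re (1 : K) = 1.
Proof. by case: k. Qed.

Lemma scalar_re_sum (I : Type) (r : seq I) (F : I -> K) :
  scalar_re (\sum_(i <- r) F i) = \sum_(i <- r) scalar_re (F i).
Proof. exact: (big_morph _ scalar_reD scalar_re0). Qed.

Lemma ler_scalar_re (x y : K) : x <= y -> scalar_re x <= scalar_re y.
Proof. by case: k x y => //= x y; rewrite lecE => /andP[]. Qed.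

Lemma ge0_scalar_re_eq0 (x : K) : 0 <= x -> scalar_re x = 0 -> x = 0.
Proof.
by case: k x => //= -[a b]; rewrite lecE /= => /andP[/eqP -> _] ->.
Qed.

(** The real part is multiplicative as soon as one factor is real; this is what
    makes [rnorm] homogeneous. *)
Lemma ge0_scalar_reM (x y : K) :
  0 <= x -> scalar_re (x * y) = scalar_re x * scalar_re y.
Proof.
case: k x y => //= -[a b] [c d]; rewrite lecE /= => /andP[/eqP -> _].
by rewrite mul0r subr0.
Qed.

Lemma scalar_conjK (x : K) : scalar_conj (scalar_conj x) = x.
Proof. by case: k x => //= x; rewrite conjcK. Qed.

Lemma rnorm_conj (x : K) : rnorm (scalar_conj x) = rnorm x.
Proof.
rewrite /rnorm; congr scalar_re; case: k x => //= x.
exact: normcJ.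
Qed.

Lemma scalar_re_mul_conj (x : K) :
  scalar_re (x * scalar_conj x) = rnorm x ^+ 2.
Proof.
rewrite /rnorm [RHS]expr2 -ge0_scalar_reM ?normr_ge0 // -expr2.
congr scalar_re; case: k x => /= x; first by rewrite real_normK ?num_real.
by rewrite -sqr_normc.
Qed.

Lemma rnorm_ge0 (V : normedZmodType K) (x : V) : 0 <= rnorm x.
Proof. by rewrite /rnorm -scalar_re0 ler_scalar_re. Qed.

Lemma rnorm_eq0 (V : normedZmodType K) (x : V) : (rnorm x == 0) = (x == 0).
Proof.
apply/eqP/eqP => [|->]; last by rewrite /rnorm normr0 scalar_re0.
by move=> /(ge0_scalar_re_eq0 (normr_ge0 x)) /eqP; rewrite normr_eq0 => /eqP.
Qed.

Lemma ler_rnorm_sum (V : normedZmodType K) (I : Type) (r : seq I) (F : I -> V) :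
  rnorm (\sum_(i <- r) F i) <= \sum_(i <- r) rnorm (F i).
Proof. by rewrite /rnorm -scalar_re_sum ler_scalar_re // ler_norm_sum. Qed.

Lemma rnormZ (V : normedModType K) (c : K) (x : V) :
  rnorm (c *: x) = rnorm c * rnorm x.
Proof. by rewrite /rnorm normrZ ge0_scalar_reM. Qed.

End Scalars.

(** * Jensen's inequality for powers *)

Section WeightedJensen.
Context {R : realType}.

(** This is Jensen's inequality for the weights [w i / W], [W] being the sum of
    the [w i], multiplied by [W `^ r]: keeping the weights unnormalized makes it
    hold for [W = 0] as well. *)
Lemma powR_weighted_sum_le (I : finType) (w b : I -> R) (r : R) :
    1 <= r -> (forall i, 0 <= w i) -> (forall i, 0 <= b i) ->
  (\sum_i w i * b i) `^ r <= (\sum_i w i) `^ (r - 1) * \sum_i w i * b i `^ r.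
Proof.
move=> r1 w0 b0; have r0 : 0 < r by exact: lt_le_trans r1.
set W := \sum_i w i; set S := \sum_i _; set T := \sum_i w i * b i `^ r.
have W0 : 0 <= W by apply: sumr_ge0.
have S0 : 0 <= S by apply: sumr_ge0 => i _; rewrite mulr_ge0.
have T0 : 0 <= T by apply: sumr_ge0 => i _; rewrite mulr_ge0 ?powR_ge0.
have [Weq|Wneq] := eqVneq W 0.
  suff -> : S = 0 by rewrite powR0 ?gt_eqF // mulr_ge0 ?powR_ge0.
  apply: big1 => i _; suff -> : w i = 0 by rewrite mul0r.
  exact: (psumr_eq0P _ Weq).
have [req|rneq] := eqVneq r 1.
  rewrite req subrr powRr0 mul1r powRr1 //.
  by apply: ler_sum => i _; rewrite req powRr1.
have r1' : 0 < r - 1 by rewrite subr_gt0 lt_neqAle eq_sym rneq.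
have Wgt : 0 < W by rewrite lt_neqAle eq_sym Wneq.
pose m := S / W.
have m0 : 0 <= m by rewrite divr_ge0.
have SE : S = W * m by rewrite mulrC divfK.
pose s := r / (r - 1).
have s0 : 0 < s by rewrite divr_gt0.
have rs : r^-1 + s^-1 = 1.
  by rewrite /s invf_div -[X in X + _]mul1r -mulrDl addrC subrK divff ?gt_eqF.
(* [m] is the weighted mean of the [b i]. Young's inequality with conjugate
   exponents [r] and [s] says that the power function lies above its tangent
   at [m]; averaging over the weights makes the linear term vanish. *)
have young i : w i * (b i * m `^ (r - 1)) <= w i * (b i `^ r / r + m `^ r / s).
  apply: ler_wpM2l => //.
  have := conjugate_powR (b0 i) (powR_ge0 m (r - 1)) r0 s0 rs.
  by rewrite -powRrM /s mulrCA divff ?gt_eqF // mulr1.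
have := ler_sum (index_enum I) (fun i (_ : true) => young i).
rewrite (eq_bigr (fun i => (w i * b i) * m `^ (r - 1))); last first.
  by move=> i _; rewrite mulrA.
rewrite -mulr_suml -/S [X in _ <= X -> _](eq_bigr (fun i =>
    (w i * b i `^ r) / r + w i * (m `^ r / s))); last first.
  by move=> i _; rewrite mulrDr mulrA.
rewrite big_split /= -!mulr_suml -/T -/W SE -mulrA mulr_powRB1 //.
rewrite mulrA -lerBlDr -[X in X - _]mulr1 -mulrBr -{1}rs addrK.
rewrite ler_pM2r ?invr_gt0 //.
move=> key; rewrite powRM // -(mulr_powRB1 W0 r0).
by rewrite -mulrA mulrCA ler_wpM2l ?powR_ge0.
Qed.

End WeightedJensen.

(** * The l^q bound for combinations of columns *)

Section Lpnorm.
Context {R : realType} {k : scalar_kind}.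
Local Notation K := (scalars R k).

Lemma lpnorm_ge0 (V : normedZmodType K) N (p : \bar R) (f : 'I_N -> V) :
  0 <= lpnorm p f.
Proof. by case: p => [r||] //=; [exact: powR_ge0 | exact: bigmax_ge_id]. Qed.

Lemma lpnorm1E (V : normedZmodType K) N (f : 'I_N -> V) :
  lpnorm 1 f = \sum_(n < N) rnorm (f n).
Proof.
rewrite /= invr1 powRr1; last by apply: sumr_ge0 => n _; exact: powR_ge0.
by apply: eq_bigr => n _; rewrite powRr1 ?rnorm_ge0.
Qed.

Lemma lpnorm_gt0 (V : normedZmodType K) N (p : \bar R) (f : 'I_N -> V) :
  (1 <= p)%E -> f != 0 -> 0 < lpnorm p f.
Proof.
move=> p1 /eqP f0.
have [n fn] : exists n, f n != 0.
  apply: contrapT => /forallNP all0; apply: f0; apply/funext => n.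
  by apply/eqP/negPn/negP; exact: all0.
have fn0 : 0 < rnorm (f n) by rewrite lt_neqAle eq_sym rnorm_eq0 fn rnorm_ge0.
case: p p1 => [r| |//] /= _; last exact: lt_le_trans (le_bigmax _ _ n).
apply: powR_gt0; apply: (lt_le_trans (powR_gt0 r fn0)).
by rewrite (bigD1 n) //= lerDl; apply: sumr_ge0 => i _; exact: powR_ge0.
Qed.

Lemma lpnorm_le_kappa N (p : \bar R) (A : 'M[K]_N) j :
  lpnorm p (fun n => A n j) <= kappa p A.
Proof. exact: (le_bigmax 0 (fun j => lpnorm p (fun n => A n j))). Qed.

Lemma kappa_ge0 N (p : \bar R) (A : 'M[K]_N) : 0 <= kappa p A.
Proof. exact: bigmax_ge_id. Qed.

(** The triangle inequality in l^q for [X]-valued coefficients. For finite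
    [q = r], Jensen's inequality is applied in each row [j] with the weights
    [rnorm (g n)]; exchanging the sums over [j] and [n] then leaves the [r]-th
    powers of the column norms, each at most [C `^ r]. *)
Lemma lpnorm_mx_le (X : normedModType K) N (p : \bar R) (A : 'M[K]_N)
    (g : 'I_N -> X) : (1 <= p)%E ->
  lpnorm p (fun j => \sum_(n < N) A j n *: g n) <= kappa p A * lpnorm 1 g.
Proof.
move=> p1; rewrite lpnorm1E.
set W := \sum_(n < N) _.
move: (kappa_ge0 p A) (lpnorm_le_kappa p A); move: (kappa p A) => C C0 colC.
have W0 : 0 <= W by apply: sumr_ge0 => n _; exact: rnorm_ge0.
have triangle j : rnorm (\sum_(n < N) A j n *: g n) <=
    \sum_(n < N) rnorm (g n) * rnorm (A j n).
  apply: le_trans (ler_rnorm_sum _ _) _.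
  by apply: ler_sum => n _; rewrite rnormZ mulrC.
case: p p1 colC => [r| |//] p1 /= colC; last first.
  apply: bigmax_le => [|j _]; first exact: mulr_ge0.
  apply: le_trans (triangle j) _; rewrite mulr_sumr; apply: ler_sum => n _.
  rewrite mulrC ler_wpM2r ?rnorm_ge0 //; apply: le_trans (colC n).
  exact: (le_bigmax 0 (fun j => rnorm (A j n))).
rewrite lee_fin in p1; have r0 : 0 < r by exact: lt_le_trans p1.
have powC n : \sum_(j < N) rnorm (A j n) `^ r <= C `^ r.
  have S0 : 0 <= \sum_(j < N) rnorm (A j n) `^ r.
    by apply: sumr_ge0 => j _; exact: powR_ge0.
  rewrite -[leLHS]powRr1 // -(@mulVf _ r) ?gt_eqF // powRrM.
  by apply: ge0_ler_powR (colC n); rewrite ?nnegrE ?powR_ge0 // ltW.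
rewrite -[leRHS]powRr1 ?mulr_ge0 // -(@divff _ r) ?gt_eqF // powRrM.
apply: ge0_ler_powR; rewrite ?nnegrE ?powR_ge0 //.
  by rewrite invr_ge0 ltW.
  by apply: sumr_ge0 => j _; exact: powR_ge0.
apply: (@le_trans _ _ (\sum_(j < N)
    W `^ (r - 1) * \sum_(n < N) rnorm (g n) * rnorm (A j n) `^ r)).
  apply: ler_sum => j _.
  apply: le_trans (powR_weighted_sum_le p1 (fun n => rnorm_ge0 (g n))
    (fun n => rnorm_ge0 (A j n))).
  apply: ge0_ler_powR; rewrite ?nnegrE ?rnorm_ge0 //; first exact: ltW.
  exact: le_trans (rnorm_ge0 _) (triangle j).
rewrite -mulr_sumr exchange_big /= powRM // -(mulr_powRB1 W0 r0).
rewrite mulrA [leRHS]mulrC ler_wpM2l ?powR_ge0 // mulr_sumr.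
apply: ler_sum => n _; rewrite -mulr_sumr [leRHS]mulrC.
by rewrite ler_wpM2l ?rnorm_ge0.
Qed.

Lemma kappa2_le1 N (A : 'M[K]_N) :
    (forall j, \sum_(n < N) A n j * scalar_conj (A n j) = 1) ->
  kappa 2%:E A <= 1.
Proof.
move=> unitA; apply: bigmax_le => // j _ /=.
rewrite (_ : \sum_(n < N) _ = 1) ?powR1 //.
rewrite -[RHS](@scalar_re1 _ k) -(unitA j) scalar_re_sum.
by apply: eq_bigr => n _; rewrite scalar_re_mul_conj powR_mulrn ?rnorm_ge0.
Qed.

Lemma kappa_infty_adjoint N (U : 'M[K]_N) :
  kappa +oo%E (adjoint U) = coherence U.
Proof.
rewrite /kappa /coherence [RHS]exchange_big_idem /= ?maxxx //.
apply: eq_bigr => i _; apply: eq_bigr => j _.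
by rewrite !mxE rnorm_conj.
Qed.

End Lpnorm.

(** * The graph Fourier transform and its inverse *)

Section Fourier.
Context {R : realType} {k : scalar_kind}.
Local Notation K := (scalars R k).

Lemma basis_mx_unitaryl N (u : 'I_N -> 'cV[K]_N) :
  orthonormal_basis u -> adjoint (basis_mx u) *m basis_mx u = 1%:M.
Proof.
move=> [_ ou]; apply/matrixP => i j; rewrite !mxE eq_sym -ou.
by apply: eq_bigr => n _; rewrite !mxE mulrC.
Qed.

(** Orthonormality of the columns of a square matrix gives that of its rows,
    because a left inverse is a right inverse. *)
Lemma basis_mx_unitaryr N (u : 'I_N -> 'cV[K]_N) :
  orthonormal_basis u -> basis_mx u *m adjoint (basis_mx u) = 1%:M.
Proof. by move=> ou; apply: mulmx1C; exact: basis_mx_unitaryl. Qed.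

Lemma fourierE (X : normedModType K) N (U : 'M[K]_N) (f : 'I_N -> X) j :
  fourier U f j = \sum_(n < N) adjoint U j n *: f n.
Proof. by apply: eq_bigr => n _; rewrite !mxE. Qed.

Lemma fourier_inv (X : normedModType K) N (U : 'M[K]_N) (f : 'I_N -> X) n :
    U *m adjoint U = 1%:M ->
  f n = \sum_(j < N) U n j *: fourier U f j.
Proof.
move=> UU; under eq_bigr do rewrite fourierE scaler_sumr.
rewrite exchange_big /=.
under eq_bigr => m _.
  under eq_bigr => j _ do rewrite scalerA.
  rewrite -scaler_suml.
  have -> : \sum_(j < N) U n j * adjoint U j m = (n == m)%:R.
    by have /matrixP/(_ n m) := UU; rewrite !mxE.
  over.
rewrite (bigD1 n) //= eqxx scale1r big1 ?addr0 // => m mn.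
by rewrite eq_sym (negbTE mn) scale0r.
Qed.

Lemma lpnorm_fourier_le (X : normedModType K) N (p : \bar R) (U : 'M[K]_N)
    (f : 'I_N -> X) : (1 <= p)%E ->
  lpnorm p (fourier U f) <= kappa p (adjoint U) * lpnorm 1 f.
Proof.
move=> p1; rewrite (_ : fourier U f = fun j => \sum_n adjoint U j n *: f n).
  exact: lpnorm_mx_le.
by apply/funext => j; rewrite fourierE.
Qed.

Lemma lpnorm_le_fourier (X : normedModType K) N (p : \bar R) (U : 'M[K]_N)
    (f : 'I_N -> X) : U *m adjoint U = 1%:M -> (1 <= p)%E ->
  lpnorm p f <= kappa p U * lpnorm 1 (fourier U f).
Proof.
move=> UU p1; rewrite [X in lpnorm p X <= _](_ : f =
    fun n => \sum_j U n j *: fourier U f j); first exact: lpnorm_mx_le.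
by apply/funext => n; exact: fourier_inv.
Qed.

Lemma fourier_neq0 (X : normedModType K) N (U : 'M[K]_N) (f : 'I_N -> X) :
  U *m adjoint U = 1%:M -> f != 0 -> fourier U f != 0.
Proof.
move=> UU; apply: contra_neq => fh0; apply/funext => n.
by rewrite (fourier_inv _ _ UU) fh0 big1 // => j _; exact: scaler0.
Qed.

End Fourier.

(** * The uncertainty inequality *)

Lemma ler_pM_cross (R : realDomainType) (a a' b b' c c' : R) :
    0 <= b -> 0 <= b' -> b <= c * a' -> b' <= c' * a ->
  b * b' <= c * c' * (a * a').
Proof. by move=> *; rewrite [a * a']mulrC mulrACA ler_pM. Qed.

(** Positivity of [b] forces that of [c], so the division by [c] is genuine. *)
Lemma inv_le_ratio (R : realFieldType) (a b c : R) :
  0 <= a -> 0 < b -> b <= c * a -> 1 / c <= a / b.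
Proof.
move=> a0 b0 bca; have c0 : 0 < c.
  rewrite ltNge; apply/negP => c0; have := lt_le_trans b0 bca.
  by rewrite ltNge mulr_le0_ge0.
by rewrite ler_pdivlMr // mulrAC ler_pdivrMr // mul1r mulrC.
Qed.

Theorem theorem3p2 (R : realType) (k : scalar_kind) (N : nat) (hN : (1 <= N)%N)
    (u : 'I_N -> 'cV[scalars R k]_N) (hu : orthonormal_basis u)
    (X : completeNormedModType (scalars R k)) (f : 'I_N -> X) (hf : f != 0) :
  let U := basis_mx u in
  let fh := fourier U f in
  (forall q : \bar R, (1 <= q)%E ->
     (lpnorm 1 f * lpnorm 1 fh) / (lpnorm q f * lpnorm q fh)
       >= 1 / (kappa q U * kappa q (adjoint U))) /\
  (lpnorm 1 f * lpnorm 1 fh) / (lpnorm +oo%E f * lpnorm +oo%E fh)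
    >= 1 / coherence U ^+ 2 /\
  (lpnorm 1 f * lpnorm 1 fh) / (lpnorm 2%:E f * lpnorm 2%:E fh) >= 1.
Proof.
move=> U fh.
have UU : U *m adjoint U = 1%:M := basis_mx_unitaryr hu.
have fh0 : fh != 0 := fourier_neq0 UU hf.
have A0 : 0 <= lpnorm 1 f * lpnorm 1 fh by rewrite mulr_ge0 ?lpnorm_ge0.
have B0 q : (1 <= q)%E -> 0 < lpnorm q f * lpnorm q fh.
  by move=> q1; rewrite mulr_gt0 ?lpnorm_gt0.
have key q : (1 <= q)%E -> lpnorm q f * lpnorm q fh <=
    kappa q U * kappa q (adjoint U) * (lpnorm 1 f * lpnorm 1 fh).
  move=> q1; have := lpnorm_fourier_le U f q1.
  have := lpnorm_le_fourier f UU q1.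
  by apply: ler_pM_cross; exact: lpnorm_ge0.
split; [|split].
- by move=> q q1; apply: inv_le_ratio; [|exact: B0|exact: key].
- apply: inv_le_ratio => //; first by rewrite B0 ?leey.
  by rewrite expr2 -{2}kappa_infty_adjoint; apply: key; rewrite leey.
have le12 : (1 <= 2%:E :> \bar R)%E by rewrite lee_fin ler1n.
rewrite ler_pdivlMr ?B0 // mul1r; apply: le_trans (key _ le12) _.
rewrite ler_piMl // mulr_ile1 ?kappa_ge0 // kappa2_le1 // => j.
  rewrite -[RHS](_ : (adjoint U *m U) j j = 1).
    by rewrite mxE; apply: eq_bigr => n _; rewrite !mxE mulrC.
  by rewrite basis_mx_unitaryl // mxE eqxx.
(* The columns of the adjoint are the conjugated rows of [U]. *)
rewrite -[RHS](_ : (U *m adjoint U) j j = 1); last by rewrite UU mxE eqxx.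
by rewrite mxE; apply: eq_bigr => n _; rewrite !mxE scalar_conjK mulrC.
Qed.
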